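(* Let $\mathcal P$ and $\mathcal Q$ be symmetric operads in simplicial sets. For every $n\ge1$, the $n$-th divided powers functor $\gamma_n^{\mathfrak S}:\mathfrak S\mathsf{Seq}\to\mathfrak S\mathsf{Seq}$ restricts and corestricts to a functor $$\gamma_n^{\mathfrak S}:\mathsf{Bimod}_{\mathcal P,\mathcal Q}\to\mathsf{Bimod}_{\mathcal P,\mathcal Q},$$ i.e. there is a functor $\mathsf{Bimod}_{\mathcal P,\mathcal Q}\to\mathsf{Bimod}_{\mathcal P,\mathcal Q}$ lifting $\gamma_n^{\mathfrak S}$ along the forgetful functor $\mathsf{Bimod}_{\mathcal P,\mathcal Q}\to\mathfrak S\mathsf{Seq}$.
   Context: $\mathfrak S\mathsf{Seq}$ is the category of symmetric sequences $\mathcal X=(\mathcal X(n))_{n\ge0}$ of simplicial sets, with right $\mathfrak S_n$-actions. A symmetric operad is a monoid for the standard composition product $\circ$ of symmetric sequences. $\mathsf{Bimod}_{\mathcal P,\mathcal Q}$ is the category of symmetric sequences with compatible left $\mathcal P$-action and right $\mathcal Q$-action with respect to $\circ$. The $n$-th divided powers functor $\gamma_n^{\mathfrak S}$ is given by $\gamma_n^{\mathfrak S}(\mathcal X)(m)=\mathcal X(mn)$, with $\mathfrak S_m$ acting through $\mathfrak S_m\to\mathfrak S_{mn}$, $\sigma\mapsto\nu_{m,n}(\sigma,e_n)$, where $\nu_{m,n}(\sigma,\tau)(i,j)=(\sigma(i),\tau(j))$ and $(i,j)\in\{1,\dots,m\}\times\{1,\dots,n\}$ is identified with $(i-1)n+j$.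 *)

(* Defs.v *)
From Stdlib Require Import Relations.
From mathcomp Require Import all_boot fingroup perm.
From mathcomp Require Import boolp.
From mathcomp Require Import mxtens.

Set Implicit Arguments.
Unset Strict Implicit.
Unset Printing Implicit Defensive.

Record category := Category {
  obj :> Type;
  hom : obj -> obj -> Type;
  idm : forall A, hom A A;
  compm : forall A B C, hom B C -> hom A B -> hom A C;
  compm1 : forall A B (f : hom A B), compm f (idm A) = f;
  comp1m : forall A B (f : hom A B), compm (idm B) f = f;
  compmA : forall A B C D (h : hom C D) (g : hom B C) (f : hom A B),
    compm h (compm g f) = compm (compm h g) f
}.
Arguments idm {c} A.

Notation "g ** f" := (compm g f) (at level 40, left associativity).

Record functor (C D : category) := Functor {
  fobj :> C -> D;
  fmap : forall A B, hom A B -> hom (fobj A) (fobj B);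
  fmap_id : forall A, fmap (idm A) = idm (fobj A);
  fmap_comp : forall A B E (g : hom B E) (f : hom A B),
    fmap (g ** f) = fmap g ** fmap f
}.
Arguments fmap {C D} F {A B} : rename.

Program Definition functor_comp (C D E : category)
    (G : functor D E) (F : functor C D) : functor C E :=
  @Functor C E (fun A => G (F A)) (fun A B f => fmap G (fmap F f)) _ _.
Next Obligation. by rewrite !fmap_id. Qed.
Next Obligation. by rewrite !fmap_comp. Qed.

(* [simp_op d e] is the hom-set from [d] to [e] in the simplex category; the
   ordinal [d] = {0 < ... < d} is ['I_d.+1]. *)
Record simp_op (d e : nat) := SimpOp {
  simp_fun :> 'I_d.+1 -> 'I_e.+1;
  simp_mono : {homo simp_fun : i j / (i <= j)%N}
}.

Definition simp_id d : simp_op d d := @SimpOp d d id (fun _ _ h => h).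

Definition simp_comp c d e (t : simp_op d e) (u : simp_op c d) : simp_op c e :=
  @SimpOp c e (fun i => t (u i)) (fun _ _ h => simp_mono t (simp_mono u h)).

Record sset := SSet {
  simplex :> nat -> Type;
  smap : forall d e, simp_op d e -> simplex e -> simplex d;
  smap_id : forall d (x : simplex d), smap (simp_id d) x = x;
  smap_comp : forall c d e (t : simp_op d e) (u : simp_op c d) (x : simplex e),
    smap (simp_comp t u) x = smap u (smap t x)
}.
Arguments smap {X d e} t x : rename.

Record sset_hom (X Y : sset) := SSetHom {
  shom_fun :> forall d, X d -> Y d;
  shom_nat : forall d e (t : simp_op d e) (x : X e),
    shom_fun (smap t x) = smap t (shom_fun x)
}.
Arguments shom_fun {X Y} s d x : rename.

Lemma sset_hom_eq (X Y : sset) (f g : sset_hom X Y) :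
  (forall d (x : X d), f d x = g d x) -> f = g.
Proof.
case: f g => [f hf] [g hg] /= fg.
have {}fg : f = g by apply: functional_extensionality_dep => d; apply/funext.
by subst g; congr SSetHom; exact: Prop_irrelevance.
Qed.

(* Permutations in MathComp compose from left to right: [(t * s)%g i = s (t i)],
   so [(t * s)%g] is the usual composite of [s] after [t], and [sactM] is the
   axiom of a right action of the usual symmetric group.  We think of [x : X n]
   as an operation with inputs ['I_n]; the [i]-th input of [sact s x] is the
   [s i]-th input of [x]. *)
Record sseq := MkSSeq {
  scar :> nat -> sset;
  sact : forall n, 'S_n -> sset_hom (scar n) (scar n);
  sact1 : forall n d (x : scar n d), sact 1%g d x = x;
  sactM : forall n (s t : 'S_n) d (x : scar n d),
    sact (t * s)%g d x = sact t d (sact s d x)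
}.
Arguments sact {X n} s : rename.

Record sseq_hom (X Y : sseq) := SSeqHom {
  qhom :> forall n, sset_hom (X n) (Y n);
  qhom_act : forall n (s : 'S_n) d (x : X n d),
    qhom n d (sact s d x) = sact s d (qhom n d x)
}.

Lemma sseq_hom_eq (X Y : sseq) (f g : sseq_hom X Y) :
  (forall n d (x : X n d), f n d x = g n d x) -> f = g.
Proof.
case: f g => [f hf] [g hg] /= fg.
have {}fg : f = g.
  by apply: functional_extensionality_dep => n; apply: sset_hom_eq => d x.
by subst g; congr SSeqHom; exact: Prop_irrelevance.
Qed.

Program Definition sseq_id (X : sseq) : sseq_hom X X :=
  @SSeqHom X X (fun n => @SSetHom (X n) (X n) (fun d x => x) _) _.

Program Definition sseq_comp (X Y Z : sseq) (g : sseq_hom Y Z)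
    (f : sseq_hom X Y) : sseq_hom X Z :=
  @SSeqHom X Z
    (fun n => @SSetHom (X n) (Z n) (fun d x => g n d (f n d x)) _) _.
Next Obligation. by rewrite !shom_nat. Qed.
Next Obligation. by rewrite !qhom_act. Qed.

Program Definition SSeq : category :=
  @Category sseq sseq_hom sseq_id sseq_comp _ _ _.
Next Obligation. exact: sseq_hom_eq. Qed.
Next Obligation. exact: sseq_hom_eq. Qed.
Next Obligation. exact: sseq_hom_eq. Qed.

Section Quotient.
Variables (T : Type) (R : T -> T -> Prop).

Definition gen_eqv : rel {classic T} :=
  fun x y => `[< clos_refl_sym_trans T R x y >].

Lemma gen_eqv_refl : reflexive gen_eqv.
Proof. by move=> x; apply/asboolP; apply: rst_refl. Qed.

Lemma gen_eqv_sym : symmetric gen_eqv.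
Proof. by move=> x y; apply/asboolP/asboolP; apply: rst_sym. Qed.

Lemma gen_eqv_trans : transitive gen_eqv.
Proof. by move=> y x z /asboolP xy /asboolP yz; apply/asboolP/(rst_trans _ _ _ _ _ xy). Qed.

Canonical gen_eqv_rel := EquivRel gen_eqv gen_eqv_refl gen_eqv_sym gen_eqv_trans.

Definition quot : Type := {eq_quot gen_eqv}%qT.

Definition cls (x : T) : quot := (\pi_{eq_quot gen_eqv} (x : {classic T}))%qT.

Definition rep (q : quot) : T := generic_quotient.repr q.

Lemma repK q : cls (rep q) = q.
Proof. exact: reprK. Qed.

Lemma cls_step x y : R x y -> cls x = cls y.
Proof. by move=> xy; apply/eqmodP/asboolP; apply: rst_step. Qed.

Lemma rep_cls (U : Type) (f : T -> U) :
  (forall x y, R x y -> f x = f y) -> forall x, f (rep (cls x)) = f x.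
Proof.
move=> hf x.
have /eqmodP/asboolP : cls (rep (cls x)) = cls x by apply: repK.
move: (rep (cls x)) => z.
by elim=> // u v w _ -> _ ->.
Qed.

End Quotient.

Lemma inj_surj_bij (A B : choiceType) (f : A -> B) :
  injective f -> (forall b, exists a, f a = b) -> bijective f.
Proof.
move=> inj surj; have ex b : exists a, f a == b by have [a <-] := surj b; exists a.
have fK b : f (xchoose (ex b)) = b by apply/eqP/(xchooseP (ex b)).
by exists (fun b => xchoose (ex b)) => // a; apply: inj.
Qed.

Definition tag_reindex (I J : Type) (B : J -> Type) (f : I -> J)
    (u : {i : I & B (f i)}) : {j : J & B j} :=
  existT B (f (tag u)) (tagged u).

Definition tag_map (I : Type) (A B : I -> Type) (f : forall i, A i -> B i)
    (u : {i : I & A i}) : {i : I & B i} :=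
  existT B (tag u) (f (tag u) (tagged u)).

Definition tag_assoc (I : Type) (A : I -> Type) (B : {i : I & A i} -> Type)
    (u : {i : I & {j : A i & B (existT A i j)}}) : {v : {i : I & A i} & B v} :=
  existT B (existT A (tag u) (tag (tagged u))) (tagged (tagged u)).

Lemma tag_reindex_bij (I J : choiceType) (B : J -> choiceType) (f : I -> J) :
  bijective f -> bijective (@tag_reindex I J B f).
Proof.
move=> bf; apply: inj_surj_bij => [[i x] [i' x'] /eqP|[j y]].
  rewrite -tag_eqE /tag_eq /= => /andP[/eqP/(bij_inj bf) ei]; subst i'.
  by rewrite tagged_asE => /eqP ->.
have [g _ gK] := bf; case: _ / (gK j) y => y.
by exists (existT (fun i => B (f i)) (g j) y).
Qed.

Lemma tag_map_bij (I : choiceType) (A B : I -> choiceType)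
    (f : forall i, A i -> B i) :
  (forall i, bijective (f i)) -> bijective (tag_map f).
Proof.
move=> bf; apply: inj_surj_bij => [[i x] [i' x'] /eqP|[i y]].
  rewrite -tag_eqE /tag_eq /= => /andP[/eqP ei]; subst i'.
  by rewrite tagged_asE => /eqP/(bij_inj (bf i)) ->.
by have [g _ gK] := bf i; exists (existT A i (g y)); rewrite /tag_map /= gK.
Qed.

Lemma tag_assoc_bij (I : Type) (A : I -> Type) (B : {i : I & A i} -> Type) :
  bijective (@tag_assoc I A B).
Proof.
exists (fun w : {v : {i : I & A i} & B v} =>
  let: existT v z := w in
  (let: existT i j := v return
     B v -> {i : I & {j : A i & B (existT A i j)}} in
   fun z => existT _ i (existT _ j z)) z); first by move=> [i [j z]].
by move=> [[i j] z].
Qed.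

(* The standard formula
     (X o Y)(n) = \coprod_k X(k) *_{S_k} (\coprod_{a_1 + ... + a_k = n}
         (Y(a_1) * ... * Y(a_k)) *_{S_{a_1} * ... * S_{a_k}} S_n)
   is implemented degreewise.  An element of [cpre X Y n d] is a [d]-simplex of
   the total space before passing to coinvariants; instead of an element of
   [S_n] and an equation [a_1 + ... + a_k = n], it stores a bijection [cl] from
   the disjoint union of the ['I_(a_i)] to ['I_n], which labels the inputs of
   the [y_i] by the inputs of the composite. *)
Definition slots k (a : 'I_k -> nat) : finType := {i : 'I_k & 'I_(a i)}.

Record cpre (X Y : sseq) (n d : nat) := CPre {
  ck : nat;
  cx : X ck d;
  ca : 'I_ck -> nat;
  cy : forall i, Y (ca i) d;
  cl : slots ca -> 'I_n;
  clP : bijective cl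
}.
Arguments ca {X Y n d} c _.
Arguments cy {X Y n d} c i.
Arguments cl {X Y n d} c _.
Arguments clP {X Y n d} c.

(* The relations defining the coinvariants:
     (x ; y_1 . s_1, ..., y_k . s_k ; l o (s_1 + ... + s_k)) ~ (x ; y ; l)
     (x . s ; y_{s(1)}, ..., y_{s(k)} ; l o s) ~ (x ; y ; l)
   where, in the second one, [s] permutes the blocks of slots. *)
Inductive cstep (X Y : sseq) (n d : nat) : cpre X Y n d -> cpre X Y n d -> Prop :=
| cstep_inner k (x : X k d) (a : 'I_k -> nat) (y : forall i, Y (a i) d)
    (s : forall i, 'S_(a i)) (l : slots a -> 'I_n) (h : bijective l)
    (h' : bijective (l \o tag_map (fun i => s i : 'I_(a i) -> 'I_(a i)))) :
    cstep (CPre x (fun i => sact (s i) d (y i)) h') (CPre x y h)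
| cstep_outer k (x : X k d) (a : 'I_k -> nat) (y : forall i, Y (a i) d)
    (s : 'S_k) (l : slots a -> 'I_n) (h : bijective l)
    (h' : bijective (l \o @tag_reindex 'I_k 'I_k (fun i => 'I_(a i)) s)) :
    cstep (@CPre X Y n d k (sact s d x) (fun i => a (s i)) (fun i => y (s i)) _ h')
          (CPre x y h).

Definition cset (X Y : sseq) (n d : nat) : Type := quot (@cstep X Y n d).

Lemma cpre_eq (X Y : sseq) n d k (x x' : X k d) (a : 'I_k -> nat) (y y' : forall i, Y (a i) d)
    (l l' : slots a -> 'I_n) (h : bijective l) (h' : bijective l') :
  x = x' -> (forall i, y i = y' i) -> l =1 l' -> CPre x y h = CPre x' y' h'.
Proof.
move=> -> yy ll; have {}yy : y = y' by apply: functional_extensionality_dep.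
have {}ll : l = l' by apply/funext.
by subst; congr CPre; apply: Prop_irrelevance.
Qed.

Section CsetMap.
Variables (X Y X' Y' : sseq) (n n' d d' : nat).
Variables (f : forall k, X k d -> X' k d') (g : forall k, Y k d -> Y' k d').
Variables (e : 'I_n -> 'I_n') (he : bijective e).

Definition cpre_map (u : cpre X Y n d) : cpre X' Y' n' d' :=
  CPre (f (cx u)) (fun i => g (cy u i)) (bij_comp he (clP u)).

Definition cset_map (q : cset X Y n d) : cset X' Y' n' d' :=
  cls (@cstep X' Y' n' d') (cpre_map (rep q)).

Definition equivariant (Z Z' : sseq) (p : forall k, Z k d -> Z' k d') :=
  forall k (s : 'S_k) (z : Z k d), p k (sact s d z) = sact s d' (p k z).

Hypotheses (hf : equivariant f) (hg : equivariant g).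

Lemma cset_mapE u :
  cset_map (cls (@cstep X Y n d) u) = cls (@cstep X' Y' n' d') (cpre_map u).
Proof.
apply: (rep_cls (f := fun u => cls (@cstep X' Y' n' d') (cpre_map u))).
move=> _ _ [k x a y s l h h'|k x a y s l h h']; apply: cls_step.
  rewrite /cpre_map /=.
  set v := CPre _ _ (bij_comp he h'); set w := CPre _ _ _.
  suff -> : v = CPre (f x) (fun i => sact (s i) d' (g (y i))) (bij_comp he h').
    exact: cstep_inner.
  by apply: cpre_eq.
rewrite /cpre_map /= hf; exact: cstep_outer.
Qed.

End CsetMap.

Lemma cset_map_id (X Y : sseq) n d (e : 'I_n -> 'I_n) (he : bijective e)
    (f : forall k, X k d -> X k d) (g : forall k, Y k d -> Y k d) (q : cset X Y n d) :
  (forall k x, f k x = x) -> (forall k y, g k y = y) -> e =1 id ->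
  cset_map f g he q = q.
Proof.
move=> hf hg h; rewrite -[RHS]repK /cset_map; congr cls.
by case: (rep q) => k x a y l hl; apply: cpre_eq => [|i|i] /=; rewrite ?hf ?hg ?h.
Qed.

Lemma cset_map_eq (X Y X1 Y1 X2 Y2 X3 Y3 : sseq) n n1 n2 n3 d d1 d2 d3
    (f1 : forall k, X k d -> X1 k d1) (f2 : forall k, X k d -> X2 k d2)
    (f1' : forall k, X1 k d1 -> X3 k d3) (f2' : forall k, X2 k d2 -> X3 k d3)
    (g1 : forall k, Y k d -> Y1 k d1) (g2 : forall k, Y k d -> Y2 k d2)
    (g1' : forall k, Y1 k d1 -> Y3 k d3) (g2' : forall k, Y2 k d2 -> Y3 k d3)
    (e1 : 'I_n -> 'I_n1) (e2 : 'I_n -> 'I_n2)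
    (e1' : 'I_n1 -> 'I_n3) (e2' : 'I_n2 -> 'I_n3)
    (h1 : bijective e1) (h2 : bijective e2) (h1' : bijective e1')
    (h2' : bijective e2') (q : cset X Y n d) :
  equivariant f1' -> equivariant g1' -> equivariant f2' -> equivariant g2' ->
  (forall k x, f1' k (f1 k x) = f2' k (f2 k x)) ->
  (forall k y, g1' k (g1 k y) = g2' k (g2 k y)) ->
  (forall i, e1' (e1 i) = e2' (e2 i)) ->
  cset_map f1' g1' h1' (cset_map f1 g1 h1 q) =
  cset_map f2' g2' h2' (cset_map f2 g2 h2 q).
Proof.
move=> ? ? ? ? hf hg he; rewrite [cset_map f1 _ _ _]/cset_map.
rewrite [cset_map f2 _ _ _]/cset_map !cset_mapE //; congr cls.
by case: (rep q) => k x a y l hl; apply: cpre_eq => [|i|i] /=; [apply: hf|apply: hg|apply: he].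
Qed.

Lemma cset_map_comp (X Y X1 Y1 X3 Y3 : sseq) n n1 n3 d d1 d3
    (f1 : forall k, X k d -> X1 k d1) (f1' : forall k, X1 k d1 -> X3 k d3)
    (f : forall k, X k d -> X3 k d3)
    (g1 : forall k, Y k d -> Y1 k d1) (g1' : forall k, Y1 k d1 -> Y3 k d3)
    (g : forall k, Y k d -> Y3 k d3)
    (e1 : 'I_n -> 'I_n1) (e1' : 'I_n1 -> 'I_n3) (e : 'I_n -> 'I_n3)
    (h1 : bijective e1) (h1' : bijective e1') (h : bijective e)
    (q : cset X Y n d) :
  equivariant f1' -> equivariant g1' ->
  (forall k x, f k x = f1' k (f1 k x)) ->
  (forall k y, g k y = g1' k (g1 k y)) ->
  (forall i, e i = e1' (e1 i)) ->
  cset_map f g h q = cset_map f1' g1' h1' (cset_map f1 g1 h1 q).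
Proof.
move=> ? ? hf hg he; rewrite [cset_map f _ _ _]/cset_map.
rewrite [cset_map f1 _ _ _]/cset_map cset_mapE //; congr cls.
by case: (rep q) => k x a y l hl; apply: cpre_eq => [|i|i] /=; [apply: hf|apply: hg|apply: he].
Qed.

Lemma smap_equivariant (X : sseq) d d' (t : simp_op d d') :
  equivariant (fun k => @smap (X k) d d' t).
Proof. by move=> k s x; rewrite shom_nat. Qed.

Lemma qhom_equivariant (X Y : sseq) (f : sseq_hom X Y) d :
  equivariant (fun k => shom_fun (f k) d).
Proof. by move=> k s x; rewrite qhom_act. Qed.

Lemma id_equivariant (X : sseq) d : equivariant (fun k (x : X k d) => x).
Proof. by []. Qed.

#[local] Hint Resolve smap_equivariant qhom_equivariant id_equivariant : core.

Definition id_bij (T : Type) : bijective (@id T) := Bijective (frefl id) (frefl id).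

Lemma perm_bij n (s : 'S_n) : bijective s.
Proof. by exists (s^-1)%g => i; rewrite ?permK ?permKV. Qed.

Program Definition csset (X Y : sseq) (n : nat) : sset :=
  @SSet (cset X Y n)
    (fun d e t => cset_map (fun k => smap t) (fun k => smap t) (id_bij _)) _ _.
Next Obligation. by apply: cset_map_id => // k ?; rewrite smap_id. Qed.
Next Obligation. by apply: cset_map_comp => // k ?; rewrite smap_comp. Qed.

Program Definition cact (X Y : sseq) (n : nat) (s : 'S_n) :
    sset_hom (csset X Y n) (csset X Y n) :=
  @SSetHom (csset X Y n) (csset X Y n)
    (fun d => cset_map (fun k x => x) (fun k y => y)
                       (perm_bij s^-1)) _.

Next Obligation. by apply: cset_map_eq. Qed.

Program Definition ccomp (X Y : sseq) : sseq :=
  @MkSSeq (csset X Y) (@cact X Y) _ _.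
Next Obligation. by apply: cset_map_id => // i; rewrite invg1 perm1. Qed.
Next Obligation.
by apply: cset_map_comp => // i; rewrite invMg permM.
Qed.

Program Definition ccomp_hom (X X' Y Y' : sseq) (f : sseq_hom X X')
    (g : sseq_hom Y Y') : sseq_hom (ccomp X Y) (ccomp X' Y') :=
  @SSeqHom (ccomp X Y) (ccomp X' Y')
    (fun n => @SSetHom (csset X Y n) (csset X' Y' n)
       (fun d => cset_map (fun k => f k d) (fun k => g k d) (id_bij _)) _) _.
Next Obligation. by apply: cset_map_eq => // k u; rewrite shom_nat. Qed.
Next Obligation. by apply: cset_map_eq. Qed.

Local Notation mk x y h := (cls (@cstep _ _ _ _) (CPre x y h)).

Lemma cls_inner (X Y : sseq) n d k (x : X k d) (a : 'I_k -> nat)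
    (y y' : forall i, Y (a i) d) (s : forall i, 'S_(a i))
    (l l' : slots a -> 'I_n) (h : bijective l) (h' : bijective l') :
  (forall i, y' i = sact (s i) d (y i)) ->
  (forall i j, l' (existT _ i j) = l (existT _ i (s i j))) ->
  mk x y' h' = mk x y h.
Proof.
move=> yy ll.
have {}yy : y' = fun i => sact (s i) d (y i) by apply: functional_extensionality_dep.
subst y'.
have {}ll : l' = l \o tag_map (fun i => s i : 'I_(a i) -> 'I_(a i)).
  by apply/funext => -[i j]; apply: ll.
by subst l'; apply: cls_step; apply: cstep_inner.
Qed.

Lemma cls_outer (X Y : sseq) n d k (x x' : X k d) (a : 'I_k -> nat)
    (y : forall i, Y (a i) d) (s : 'S_k)
    (l : slots a -> 'I_n) (l' : slots (fun i => a (s i)) -> 'I_n)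
    (h : bijective l) (h' : bijective l') :
  x' = sact s d x ->
  (forall i j, l' (existT _ i j) = l (existT _ (s i) j)) ->
  mk x' (fun i => y (s i)) h' = mk x y h.
Proof.
move=> -> ll.
have {}ll : l' = l \o @tag_reindex 'I_k 'I_k (fun i => 'I_(a i)) s.
  by apply/funext => -[i j]; apply: ll.
by subst l'; apply: cls_step; apply: cstep_outer.
Qed.

(* [relabelled y e y']: [y'] is the restriction of [y] along the bijection [e]
   between the inputs of [y'] and those of [y]. *)
Inductive relabelled (Y : sseq) n d (y : Y n d) :
    forall n', ('I_n' -> 'I_n) -> Y n' d -> Prop :=
  Relabelled (s : 'S_n) : relabelled y s (sact s d y).

Lemma relabelledW (Y : sseq) n d (y y' : Y n d) (e : 'I_n -> 'I_n) (s : 'S_n) :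
  (forall i, e i = s i) -> y' = sact s d y -> relabelled y e y'.
Proof.
move=> es ->; have -> : e = s by apply/funext.
exact: Relabelled.
Qed.

Lemma relabelled_ex (Y : sseq) n d (y y' : Y n d) (e : 'I_n -> 'I_n) :
  relabelled y e y' -> exists s : 'S_n, e = s /\ y' = sact s d y.
Proof.
have gen n' (e' : 'I_n' -> 'I_n) (y1 : Y n' d) : relabelled y e' y1 ->
    exists (E : n = n') (s : 'S_n), (fun i => e' (cast_ord E i)) = s /\
      y1 = ecast m (Y m d) E (sact s d y).
  case=> s; exists erefl, s; split=> //.
  by apply/funext => i; rewrite cast_ord_id.
move=> /gen[E [s]]; rewrite (eq_axiomK E) /= => -[es ->]; exists s; split=> //.
by rewrite -es; apply/funext => i; rewrite cast_ord_id.
Qed.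

Lemma relabelled_size (Y : sseq) n n' d (y : Y n d) (e : 'I_n' -> 'I_n) y' :
  relabelled y e y' -> n' = n.
Proof. by case. Qed.

Lemma bij_size n m (f : 'I_n -> 'I_m) : bijective f -> n = m.
Proof. by move=> /bij_eq_card; rewrite !card_ord. Qed.

Lemma cls_relabel (X Y : sseq) n d k (x : X k d) (a a' : 'I_k -> nat)
    (y : forall i, Y (a i) d) (y' : forall i, Y (a' i) d)
    (e : forall i, 'I_(a' i) -> 'I_(a i))
    (l : slots a -> 'I_n) (l' : slots a' -> 'I_n)
    (h : bijective l) (h' : bijective l') :
  (forall i, relabelled (y i) (@e i) (y' i)) ->
  (forall i j, l' (existT _ i j) = l (existT _ i (e i j))) ->
  mk x y' h' = mk x y h.
Proof.
move=> H; have E : a' = a by apply/funext => i; apply: relabelled_size (H i).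
subst a' => ll.
have {}H i : exists s : 'S_(a i), e i = s /\ y' i = sact s d (y i).
  exact: relabelled_ex.
pose s i := projT1 (cid (H i)).
have hs i : e i = s i /\ y' i = sact (s i) d (y i) := projT2 (cid (H i)).
apply: (cls_inner x (s := s)) => [i|i j]; first by case: (hs i).
by rewrite ll; case: (hs i) => ->.
Qed.

Lemma relabelled_cls (X Y : sseq) n n' d k k' (x : X k d) (x' : X k' d)
    (a : 'I_k -> nat) (a' : 'I_k' -> nat)
    (y : forall i, Y (a i) d) (y' : forall i, Y (a' i) d)
    (l : slots a -> 'I_n) (l' : slots a' -> 'I_n')
    (h : bijective l) (h' : bijective l') (e : 'I_n' -> 'I_n) :
  bijective e ->
  (forall he : bijective (e \o l'), mk x' y' he = mk x y h) ->
  relabelled (mk x y h : ccomp X Y n d) e (mk x' y' h').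
Proof.
move=> be H; have E := bij_size be; subst n'.
apply: (@relabelledW _ _ _ _ _ _ (perm (bij_inj be))) => [i|].
  by rewrite permE.
rewrite /= -(H (bij_comp be h')) cset_mapE //; congr cls; apply: cpre_eq => //= u.
by apply: (@perm_inj _ (perm (bij_inj be))); rewrite permKV permE.
Qed.

(* The type of simplices is the proposition [n = 1]: a point in arity 1, empty in
   the other arities. *)
Program Definition cunit : sseq :=
  @MkSSeq (fun n => @SSet (fun _ => n = 1) (fun _ _ _ h => h) _ _)
         (fun n s => @SSetHom _ _ (fun _ h => h) _) _ _.

Lemma tagged_bij n : bijective (fun u : slots (fun _ : 'I_1 => n) => tagged u).
Proof.
exists (fun j : 'I_n => existT (fun _ : 'I_1 => 'I_n) ord0 j) => //.
by case=> i j /=; congr existT; rewrite [i]ord1.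
Qed.

Lemma tag_bij n : bijective (fun u : slots (fun _ : 'I_n => 1) => tag u).
Proof.
exists (fun i : 'I_n => existT (fun _ : 'I_n => 'I_1) i ord0) => //.
by case=> i j /=; congr existT; rewrite [j]ord1.
Qed.

(* The unit isomorphisms, in the direction in which no transport along an
   equality of arities is needed; the injectivity and surjectivity lemmas below
   show that they are invertible. *)
Program Definition lunitV (X : sseq) : sseq_hom X (ccomp cunit X) :=
  @SSeqHom X (ccomp cunit X)
    (fun n => @SSetHom (X n) (csset cunit X n) (fun d x =>
       cls _ (@CPre cunit X n d 1 erefl (fun _ => n) (fun _ => x) _
                (tagged_bij n))) _) _.
Next Obligation. by rewrite cset_mapE //; congr cls; apply: cpre_eq. Qed.
Next Obligation.
rewrite cset_mapE //.
by apply: (cls_inner _ (s := fun=> s)) => //= i j; rewrite permK.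
Qed.

Program Definition runitV (X : sseq) : sseq_hom X (ccomp X cunit) :=
  @SSeqHom X (ccomp X cunit)
    (fun n => @SSetHom (X n) (csset X cunit n) (fun d x =>
       cls _ (@CPre X cunit n d n x (fun _ => 1) (fun _ => erefl) _
                (tag_bij n))) _) _.
Next Obligation. by rewrite cset_mapE //; congr cls; apply: cpre_eq. Qed.
Next Obligation.
rewrite cset_mapE //.
by apply: (@cls_outer X cunit n d n x _ (fun=> 1) (fun=> erefl) s) => //= i j;
  rewrite permK.
Qed.

Lemma relabelled_exists (Y : sseq) n n' d (e : 'I_n' -> 'I_n) (y' : Y n' d) :
  bijective e -> exists y, relabelled y e y'.
Proof.
move=> be; have E := bij_size be; subst n'.
exists (sact (perm (bij_inj be))^-1 d y').
apply: (@relabelledW _ _ _ _ _ _ (perm (bij_inj be))) => [i|].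
  by rewrite permE.
by rewrite -sactM mulgV sact1.
Qed.

Lemma relabelled_inj (Y : sseq) n n' d (e : 'I_n' -> 'I_n) (y1 y2 : Y n d) y' :
  relabelled y1 e y' -> relabelled y2 e y' -> y1 = y2.
Proof.
move=> h1 h2; have E := relabelled_size h1; subst n'.
have [s [es y's]] := relabelled_ex h1; have [t [et y't]] := relabelled_ex h2.
have st : s = t by apply/permP => i; rewrite -es -et.
have : sact s^-1 d y' = sact t^-1 d y' by rewrite st.
by rewrite {1}y's y't -!sactM !mulVg !sact1.
Qed.

Lemma lunitV_surj X n d (q : cset cunit X n d) : exists x, lunitV X n d x = q.
Proof.
rewrite -[q]repK; case: (rep q) => k k1 a y l h.
have E : k = 1 := k1; subst k.
have be : bijective (fun j => l (existT _ ord0 j)).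
  have [f lf fl] := h; pose g i := tagged (f i).
  have f0 i : tag (f i) = ord0 by rewrite ord1.
  apply: inj_surj_bij => [j j' /(bij_inj h)/eqP|i].
    by rewrite -tag_eqE /tag_eq eqxx tagged_asE => /eqP.
  move: (fl i); case: (f i) => i0 j; move: j; rewrite [i0]ord1 => j <-.
  by exists j.
have [x hx] := relabelled_exists (y ord0) be.
exists x => /=; apply/esym; rewrite (@Prop_irrelevance (1 = 1) k1 erefl).
apply: (@cls_relabel cunit X n d 1 _ _ _ _ _ (fun i j => l (existT _ i j))) => // i.
by rewrite [i]ord1.
Qed.

Lemma relabelled_trans (Y : sseq) n d (y : Y n d) n' (e : 'I_n' -> 'I_n) y'
    (s : 'S_n') e' :
  relabelled y e y' -> (forall j, e' j = e (s j)) -> relabelled y e' (sact s d y').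
Proof.
move=> h; have E := relabelled_size h; subst n'.
have [t [-> ->]] := relabelled_ex h => es.
apply: (relabelledW (s := (s * t)%g)) => [i|]; first by rewrite permM.
by rewrite sactM.
Qed.

Lemma relabelled_transV (Y : sseq) n d (y : Y n d) n' (e : 'I_n' -> 'I_n) y'
    (s : 'S_n') e' :
  relabelled y e' (sact s d y') -> (forall j, e' j = e (s j)) -> relabelled y e y'.
Proof.
move=> h es; have -> : y' = sact s^-1 d (sact s d y').
  by rewrite -sactM mulVg sact1.
by apply: (relabelled_trans h) => j; rewrite es permKV.
Qed.

Lemma lunitV_inj X n d : injective (lunitV X n d).
Proof.
pose f (u : cpre cunit X n d) (x : X n d) :=
  forall i, relabelled x (fun j => cl u (existT _ i j)) (cy u i).
have fE := rep_cls (R := @cstep cunit X n d) (f := f).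
have {}fE : forall u, f (rep (cls (@cstep cunit X n d) u)) = f u.
  apply: fE => _ _ [k x a y s l h h'|k x a y s l h h'];
    apply/funext => w; rewrite /f /=; apply/propext; split=> H i.
  - by apply: (relabelled_transV (H i)).
  - by apply: (relabelled_trans (H i)).
  - by case: _ / (permKV s i); apply: (H (s^-1 i)%g).
  - exact: H.
move=> x x' /(congr1 (fun q => f (rep q))); rewrite /= !fE => E.
have : f (@CPre cunit X n d 1 erefl (fun=> n) (fun=> x) _ (tagged_bij n)) x.
  by move=> i; apply: (relabelledW (s := 1%g)) => [j|]; rewrite ?perm1 ?sact1.
rewrite E => /(_ ord0) /relabelled_ex[s [es /= xs]].
suff s1 : s = 1%g by rewrite xs s1 sact1.
by apply/permP => i; rewrite -es perm1.
Qed.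

Lemma runitV_surj X n d (q : cset X cunit n d) : exists x, runitV X n d x = q.
Proof.
rewrite -[q]repK; case: (rep q) => k x a y l h.
have E : a = fun=> 1 by apply/funext => i; exact: (y i : a i = 1).
subst a; have -> : y = fun=> erefl.
  by apply: functional_extensionality_dep => i; exact: (@Prop_irrelevance (1 = 1)).
have b0 : bijective (fun i : 'I_k => existT (fun _ : 'I_k => 'I_1) i ord0).
  by exists (@tag _ _) => // -[i j]; rewrite [j]ord1.
have be := bij_comp h b0; have [x' hx] := relabelled_exists x be.
have E := relabelled_size hx; subst k; have [s [es xs]] := relabelled_ex hx.
exists x' => /=; apply/esym.
apply: (@cls_outer X cunit n d n x' _ (fun=> 1) (fun=> erefl) s) => // i j /=.
by rewrite -es /= [j]ord1.
Qed.

Lemma runitV_inj X n d : injective (runitV X n d).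
Proof.
pose f (u : cpre X cunit n d) (x : X n d) :=
  forall e, (forall v, e (tag v) = cl u v) -> relabelled x e (cx u).
have one m (m1 : m = 1) (i j : 'I_m) : i = j by subst m; rewrite !ord1.
have fE := rep_cls (R := @cstep X cunit n d) (f := f).
have {}fE : forall u, f (rep (cls (@cstep X cunit n d) u)) = f u.
  apply: fE => _ _ [k x a y s l h h'|k x a y s l h h'];
    apply/funext => w; rewrite /f /=; apply/propext; split=> H e He.
  - apply: H => -[i j]; apply: etrans (He (existT _ i j)) _; congr l; congr existT.
    exact: one (y i) _ _.
  - apply: H => -[i j]; apply: etrans (He (existT _ i j)) _; congr l; congr existT.
    exact: one (y i) _ _.
  - apply: (relabelled_transV (e' := fun i => e (s i)) (s := s)) => //.
    by apply: H => -[i j] /=; apply: (He (existT _ (s i) j)).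
  - apply: (relabelled_trans (e := fun i => e (s^-1 i)%g)) => [|i]; last by rewrite permK.
    apply: H => -[i j] /=; move: j; case: _ / (permKV s i) => j; rewrite permK.
    exact: (He (existT _ _ j)).
move=> x x' /(congr1 (fun q => f (rep q))); rewrite /= !fE => E.
have : f (@CPre X cunit n d n x (fun=> 1) (fun=> erefl) _ (tag_bij n)) x.
  move=> e /= He; apply: (relabelledW (s := 1%g)) => [j|]; rewrite ?perm1 ?sact1 //.
  exact: (He (existT _ j ord0)).
rewrite E => /(_ id (fun=> erefl)) /relabelled_ex[s [es /= xs]].
suff s1 : s = 1%g by rewrite xs s1 sact1.
by apply/permP => i; rewrite -es perm1.
Qed.

Lemma enum_conj_bij (T T' : finType) (g : T -> T') :
  bijective g -> bijective (fun r : 'I_#|T| => enum_rank (g (enum_val r))).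
Proof.
by move=> hg; apply: (bij_comp (@enum_rank_bij T') (bij_comp hg (@enum_val_bij T))).
Qed.

Section Associator.
Variables X Y Z : sseq.

Section Inner.
Variables (n d k : nat) (b : 'I_k -> nat) (z : forall j, Z (b j) d).
Variables (l : slots b -> 'I_n) (hl : bijective l).

Definition assoc_slots (u : cpre X Y k d) (i : 'I_(ck u)) : finType :=
  slots (fun j : 'I_(ca u i) => b (cl u (existT _ i j))).
Arguments assoc_slots : clear implicits.

Definition assoc_label (u : cpre X Y k d)
    (w : slots (fun i => #|assoc_slots u i|)) : 'I_n :=
  let v := enum_val (tagged w) in
  l (existT _ (cl u (existT _ (tag w) (tag v))) (tagged v)).

Lemma assoc_label_bij u : bijective (@assoc_label u).
Proof.
have h1 := @tag_reindex_bij _ _ (fun j => 'I_(b j)) _ (clP u).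
have h2 := @tag_assoc_bij 'I_(ck u) (fun i => 'I_(ca u i)) (fun v => 'I_(b (cl u v))).
have h3 := @tag_map_bij _ (fun i => 'I_#|assoc_slots u i|) (@assoc_slots u)
  (fun i => @enum_val (assoc_slots u i) (assoc_slots u i))
  (fun i => @enum_val_bij (assoc_slots u i)).
exact: (bij_comp hl (bij_comp h1 (bij_comp h2 h3))).
Qed.

(* Sends ((x ; y) ; z) to (x ; (y_i ; z)_i): the slot (i, j) of [u] is fed with
   the element [z] whose index is its label [cl u (i, j)].  The inputs of
   (y_i ; z) are numbered by the enumeration of [assoc_slots]; the class does
   not depend on this choice. *)
Definition assoc_pre (u : cpre X Y k d) : cset X (ccomp Y Z) n d :=
  cls _ (@CPre X (ccomp Y Z) n d (ck u) (cx u)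
    (fun i => #|assoc_slots u i|)
    (fun i => cls _ (@CPre Y Z #|assoc_slots u i| d (ca u i) (cy u i)
                      (fun j => b (cl u (existT _ i j)))
                      (fun j => z (cl u (existT _ i j)))
                      enum_rank (@enum_rank_bij (assoc_slots u i))))
    (@assoc_label u) (assoc_label_bij u)).

End Inner.

Lemma assoc_pre_step n d k (b : 'I_k -> nat) (z : forall j, Z (b j) d)
    (l : slots b -> 'I_n) (hl : bijective l) (u v : cpre X Y k d) :
  cstep u v -> assoc_pre z hl u = assoc_pre z hl v.
Proof.
case=> [m x a y s p h h'|m x a y s p h h']; last first.
  exact: (@cls_outer X (ccomp Y Z) n d m x _ _ _ s).
pose f i := @tag_reindex 'I_(a i) 'I_(a i) (fun j => 'I_(b (p (existT _ i j)))) (s i).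
apply: (@cls_relabel X (ccomp Y Z) n d m x _ _ _ _
         (fun i r => enum_rank (f i (enum_val r)))) => i /=; last first.
  by move=> r; rewrite /assoc_label /= enum_rankK.
apply: relabelled_cls => [|he].
  have fb := @tag_reindex_bij 'I_(a i) 'I_(a i)
    (fun j => 'I_(b (p (existT _ i j)))) _ (perm_bij (s i)).
  exact: (@enum_conj_bij (slots (fun j : 'I_(a i) => b (p (existT _ i (s i j)))))
           (slots (fun j : 'I_(a i) => b (p (existT _ i j)))) _ fb).
apply: (@cls_outer Y Z _ d _ (y i) _ _ _ (s i)) => //= j r.
by rewrite enum_rankK.
Qed.

Lemma assoc_pre_inner n d k (b : 'I_k -> nat) (z z' : forall j, Z (b j) d)
    (l l' : slots b -> 'I_n) (hl : bijective l) (hl' : bijective l')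
    (s : forall j, 'S_(b j)) (u : cpre X Y k d) :
  (forall j, z' j = sact (s j) d (z j)) ->
  (forall j r, l' (existT _ j r) = l (existT _ j (s j r))) ->
  assoc_pre z' hl' u = assoc_pre z hl u.
Proof.
case: u => m x a y p h zz ll.
pose f i := @tag_map 'I_(a i) (fun j => 'I_(b (p (existT _ i j)))) _
  (fun j => s (p (existT _ i j))).
apply: (@cls_relabel X (ccomp Y Z) n d m x _ _ _ _
         (fun i r => enum_rank (f i (enum_val r)))) => i /=; last first.
  by move=> r; rewrite /assoc_label /= enum_rankK ll.
apply: relabelled_cls => [|he].
  have fb : bijective (f i).
    apply: (@tag_map_bij 'I_(a i) (fun j => 'I_(b (p (existT _ i j)))) _ _) => j.
    exact: perm_bij.
  exact: (@enum_conj_bij (slots (fun j : 'I_(a i) => b (p (existT _ i j)))) _ _ fb).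
by apply: (@cls_inner Y Z _ d _ _ _ _ _ (fun j => s (p (existT _ i j)))) => //= j r;
  rewrite enum_rankK.
Qed.

Lemma assoc_pre_outer n d k (b : 'I_k -> nat) (z : forall j, Z (b j) d)
    (l : slots b -> 'I_n) (hl : bijective l) (s : 'S_k)
    (l' : slots (fun j => b (s j)) -> 'I_n) (hl' : bijective l')
    (u : cpre X Y k d) :
  (forall j r, l' (existT _ j r) = l (existT _ (s j) r)) ->
  assoc_pre (fun j => z (s j)) hl' u =
  assoc_pre z hl (cpre_map (fun _ x => x) (fun _ y => y) (perm_bij s) u).
Proof.
case: u => m x a y p h ll.
by congr cls; apply: cpre_eq => // -[i r] /=; rewrite /assoc_label /= ll.
Qed.

Definition assoc_fun n d (w : cpre (ccomp X Y) Z n d) : cset X (ccomp Y Z) n d :=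
  assoc_pre (cy w) (clP w) (rep (cx w)).

Lemma assoc_funE n d k (u : cpre X Y k d) (b : 'I_k -> nat)
    (z : forall j, Z (b j) d) (l : slots b -> 'I_n) (hl : bijective l) :
  assoc_fun (@CPre (ccomp X Y) Z n d k (cls _ u) b z l hl) = assoc_pre z hl u.
Proof. by apply: (rep_cls (f := assoc_pre z hl)) => v w; apply: assoc_pre_step. Qed.

Lemma assoc_fun_step n d (v w : cpre (ccomp X Y) Z n d) :
  cstep v w -> assoc_fun v = assoc_fun w.
Proof.
case=> [k q b z s l hl hl'|k q b z s l hl hl'].
  exact: (@assoc_pre_inner _ _ _ _ _ _ _ _ _ _ s).
pose q' := sact s d q.
have -> : q = sact (s^-1)%g d q' by rewrite -sactM mulVg sact1.
have -> : sact s d (sact (s^-1)%g d q') = q' by rewrite -sactM mulgV sact1.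
rewrite -[q']repK /= cset_mapE // !assoc_funE.
rewrite (@assoc_pre_outer _ _ _ _ _ _ hl) //; congr assoc_pre.
by case: (rep q') => m x a y p h; apply: cpre_eq => //= i; rewrite invgK.
Qed.

Definition assoc_map n d (q : cset (ccomp X Y) Z n d) : cset X (ccomp Y Z) n d :=
  assoc_fun (rep q).

Lemma assoc_mapE n d k (u : cpre X Y k d) (b : 'I_k -> nat)
    (z : forall j, Z (b j) d) (l : slots b -> 'I_n) (hl : bijective l) :
  assoc_map (cls _ (@CPre (ccomp X Y) Z n d k (cls _ u) b z l hl)) =
  assoc_pre z hl u.
Proof.
rewrite -assoc_funE; apply: (rep_cls (f := @assoc_fun n d)) => v w.
exact: assoc_fun_step.
Qed.

End Associator.

Lemma assoc_map_nat (X X' Y Y' Z Z' : sseq) n n' d d'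
    (f : forall k, X k d -> X' k d') (g : forall k, Y k d -> Y' k d')
    (p : forall k, Z k d -> Z' k d')
    (fg : forall k, ccomp X Y k d -> ccomp X' Y' k d')
    (gp : forall k, ccomp Y Z k d -> ccomp Y' Z' k d')
    (e : 'I_n -> 'I_n') (he : bijective e) (q : ccomp (ccomp X Y) Z n d) :
  equivariant f -> equivariant g -> equivariant p ->
  (forall k w, fg k w = cset_map f g (id_bij _) w) ->
  (forall k w, gp k w = cset_map g p (id_bij _) w) ->
  assoc_map (cset_map fg p he q) = cset_map f gp he (assoc_map q).
Proof.
move=> hf hg hp fgE gpE.
have hfg : equivariant fg by move=> k s w; rewrite !fgE; apply: cset_map_eq.
have hgp : equivariant gp by move=> k s w; rewrite !gpE; apply: cset_map_eq.
rewrite -[q]repK cset_mapE //; case: (rep q) => k w b z l hl.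
rewrite -[w]repK; case: (rep w) => m x a y r hr.
rewrite assoc_mapE /cpre_map /= fgE cset_mapE // assoc_mapE cset_mapE //.
congr cls; apply: cpre_eq => //= i.
by rewrite gpE cset_mapE //; congr cls; apply: cpre_eq.
Qed.

Program Definition assoc (X Y Z : sseq) :
    sseq_hom (ccomp (ccomp X Y) Z) (ccomp X (ccomp Y Z)) :=
  @SSeqHom (ccomp (ccomp X Y) Z) (ccomp X (ccomp Y Z))
    (fun n => @SSetHom (csset (ccomp X Y) Z n) (csset X (ccomp Y Z) n)
      (fun d => @assoc_map X Y Z n d) _) _.
Next Obligation. exact: assoc_map_nat. Qed.
Next Obligation. by apply: assoc_map_nat => // k w; rewrite cset_map_id. Qed.

Canonical SSeq.

Notation "X \oc Y" := (ccomp X Y) (at level 39, left associativity).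
Notation "f \om g" := (ccomp_hom f g) (at level 39, left associativity).
Notation "1_ X" := (sseq_id X) (at level 8, X at level 2, format "1_ X").

Record operad := Operad {
  op_car :> sseq;
  op_mul : sseq_hom (op_car \oc op_car) op_car;
  op_unit : sseq_hom cunit op_car;
  op_assoc : op_mul ** (op_mul \om 1_op_car) =
             op_mul ** (1_op_car \om op_mul) ** assoc op_car op_car op_car;
  op_unitl : op_mul ** (op_unit \om 1_op_car) ** lunitV op_car = 1_op_car;
  op_unitr : op_mul ** (1_op_car \om op_unit) ** runitV op_car = 1_op_car
}.

Record bimod (P Q : operad) := BiMod {
  bm_car :> sseq;
  bm_l : sseq_hom (P \oc bm_car) bm_car;
  bm_r : sseq_hom (bm_car \oc Q) bm_car;
  bm_lA : bm_l ** (op_mul P \om 1_bm_car) =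
          bm_l ** (1_P \om bm_l) ** assoc P P bm_car;
  bm_l1 : bm_l ** (op_unit P \om 1_bm_car) ** lunitV bm_car = 1_bm_car;
  bm_rA : bm_r ** (bm_r \om 1_Q) =
          bm_r ** (1_bm_car \om op_mul Q) ** assoc bm_car Q Q;
  bm_r1 : bm_r ** (1_bm_car \om op_unit Q) ** runitV bm_car = 1_bm_car;
  bm_lr : bm_r ** (bm_l \om 1_Q) =
          bm_l ** (1_P \om bm_r) ** assoc P bm_car Q
}.

Record bimod_hom (P Q : operad) (X Y : bimod P Q) := BiModHom {
  bmh :> sseq_hom X Y;
  bmh_l : bmh ** bm_l X = bm_l Y ** (1_P \om bmh);
  bmh_r : bmh ** bm_r X = bm_r Y ** (bmh \om 1_Q)
}.

Definition forget_hom (P Q : operad) (X Y : bimod P Q) (f : bimod_hom X Y) :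
  sseq_hom X Y := f.

Lemma bimod_hom_eq (P Q : operad) (X Y : bimod P Q) (f g : bimod_hom X Y) :
  bmh f = bmh g -> f = g.
Proof.
case: f g => [f fl fr] [g gl gr] /= fg; subst g.
by congr BiModHom; apply: Prop_irrelevance.
Qed.

Lemma ccomp_hom_id (X Y : sseq) : 1_X \om 1_Y = 1_(X \oc Y).
Proof. by apply: sseq_hom_eq => n d x; apply: cset_map_id. Qed.

Lemma ccomp_hom_comp (X X' X'' Y Y' Y'' : sseq) (f' : sseq_hom X' X'')
    (f : sseq_hom X X') (g' : sseq_hom Y' Y'') (g : sseq_hom Y Y') :
  (f' ** f) \om (g' ** g) = (f' \om g') ** (f \om g).
Proof. by apply: sseq_hom_eq => n d x; apply: cset_map_comp. Qed.

Program Definition bimod_id (P Q : operad) (X : bimod P Q) : bimod_hom X X :=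
  @BiModHom P Q X X (1_X) _ _.
Next Obligation. by rewrite ccomp_hom_id compm1 comp1m. Qed.
Next Obligation. by rewrite ccomp_hom_id compm1 comp1m. Qed.

Program Definition bimod_comp (P Q : operad) (X Y Z : bimod P Q)
    (g : bimod_hom Y Z) (f : bimod_hom X Y) : bimod_hom X Z :=
  @BiModHom P Q X Z (bmh g ** bmh f) _ _.
Next Obligation.
rewrite -compmA bmh_l compmA bmh_l -compmA -ccomp_hom_comp.
by rewrite [1_P ** 1_P]comp1m.
Qed.
Next Obligation.
rewrite -compmA bmh_r compmA bmh_r -compmA -ccomp_hom_comp.
by rewrite [1_Q ** 1_Q]comp1m.
Qed.

Program Definition Bimod (P Q : operad) : category :=
  @Category (bimod P Q) (@bimod_hom P Q) (@bimod_id P Q) (@bimod_comp P Q) _ _ _.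
Next Obligation. by apply: bimod_hom_eq; apply: compm1. Qed.
Next Obligation. by apply: bimod_hom_eq; apply: comp1m. Qed.
Next Obligation. by apply: bimod_hom_eq; apply: compmA. Qed.

Canonical Bimod.

Program Definition forget (P Q : operad) : functor (Bimod P Q) SSeq :=
  @Functor (Bimod P Q) SSeq (@bm_car P Q) (fun X Y f => bmh f) _ _.

(* [mxtens_index (i, j) = i * n + j] and [mxtens_unindex] is its inverse. *)
Definition nu_fun m n (s : 'S_m) (t : 'S_n) (k : 'I_(m * n)) : 'I_(m * n) :=
  mxtens_index (s (mxtens_unindex k).1, t (mxtens_unindex k).2).

Lemma nu_inj m n (s : 'S_m) (t : 'S_n) : injective (nu_fun s t).
Proof.
apply: (can_inj (g := nu_fun s^-1 t^-1)) => k.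
by rewrite /nu_fun mxtens_indexK /= !permK -[RHS]mxtens_unindexK.
Qed.

Definition nu m n (s : 'S_m) (t : 'S_n) : 'S_(m * n) := perm (@nu_inj m n s t).

Lemma nu1 m n : @nu m n 1 1 = 1%g.
Proof.
by apply/permP => k; rewrite permE /nu_fun !perm1 -[RHS]mxtens_unindexK.
Qed.

Lemma nuM m n (s s' : 'S_m) (t t' : 'S_n) :
  nu (s * s') (t * t') = (nu s t * nu s' t')%g.
Proof.
by apply/permP => k; rewrite permM !permE /nu_fun mxtens_indexK !permM.
Qed.

Program Definition divpow_obj (n : nat) (X : sseq) : sseq :=
  @MkSSeq (fun m => X (m * n)) (fun m s => sact (nu s 1)) _ _.
Next Obligation. by rewrite nu1 sact1. Qed.
Next Obligation. by rewrite -{1}(mulg1 1%g) nuM sactM. Qed.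

Program Definition divpow_hom (n : nat) (X Y : sseq) (f : sseq_hom X Y) :
    sseq_hom (divpow_obj n X) (divpow_obj n Y) :=
  @SSeqHom (divpow_obj n X) (divpow_obj n Y) (fun m => f (m * n)) _.
Next Obligation. exact: qhom_act. Qed.

Program Definition divpow (n : nat) : functor SSeq SSeq :=
  @Functor SSeq SSeq (divpow_obj n) (@divpow_hom n) _ _.
Next Obligation. exact: sseq_hom_eq. Qed.
Next Obligation. exact: sseq_hom_eq. Qed.

(* Main.v *)
(* Write g for the divided powers functor. There are natural maps
     X o gY -> g(X o Y),  (x; y_i; l) |-> (x; y_i; l * id_n),
     gX o Y -> g(X o Y),  (x; y_i; l) |-> (x; (y_i)_(i, t); l * id_n),
   where t runs over 'I_n and the second map repeats every y_i n times. They are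
   compatible with the units and with the three ways of combining them with the
   associator, so composing them with the images under g of the two actions on a
   bimodule X gives actions on gX. *)
Require Import Defs.
From mathcomp Require Import all_boot.
From mathcomp Require Import fingroup perm boolp mxtens.

Set Implicit Arguments.
Unset Strict Implicit.
Unset Printing Implicit Defensive.

#[local] Hint Resolve smap_equivariant qhom_equivariant id_equivariant : core.

Local Notation mk x y h := (cls (@cstep _ _ _ _) (CPre x y h)).

(* The block indices computed from [mxtens_unindex] are only propositionally
   equal to the expected ones, so slots have to be transported along such
   equalities. *)
Section SlotsCast.
Variables (k k' : nat) (b : 'I_k' -> nat) (f f' : 'I_k -> 'I_k').
Hypothesis E : f =1 f'.

Definition slots_cast (u : slots (fun i => b (f i))) : slots (fun i => b (f' i)) :=
  existT _ (tag u) (cast_ord (congr1 b (E (tag u))) (tagged u)).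

Lemma slots_castE u :
  existT (fun j => 'I_(b j)) (f' (tag (slots_cast u))) (tagged (slots_cast u)) =
  existT (fun j => 'I_(b j)) (f (tag u)) (tagged u).
Proof.
case: u => i j /=; move: (E i); case: _ /.
by rewrite cast_ord_id.
Qed.

End SlotsCast.

Lemma slots_cast_id k k' (b : 'I_k' -> nat) (f : 'I_k -> 'I_k') (E : f =1 f) u :
  slots_cast (b := b) E u = u.
Proof. by case: u => i j; rewrite /slots_cast /= cast_ord_id. Qed.

(** The families [y (f i)] and [y (f' i)] have different types, so [E] cannot be rewritten
    pointwise. Function extensionality merges [f'] with [f], and the cast along [E] becomes the
    identity. *)
Lemma cls_feed (X Y : sseq) n d k k' (x : X k d) (b : 'I_k' -> nat)
    (y : forall j, Y (b j) d) (f f' : 'I_k -> 'I_k') (E : f =1 f')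
    (l : slots (fun i => b (f i)) -> 'I_n) (l' : slots (fun i => b (f' i)) -> 'I_n)
    (h : bijective l) (h' : bijective l') :
  (forall u, l u = l' (slots_cast E u)) ->
  mk x (fun i => y (f i)) h = mk x (fun i => y (f' i)) h'.
Proof.
have ff : f = f' by apply/funext.
subst f' => ll; congr cls; apply: cpre_eq => // u.
by rewrite ll slots_cast_id.
Qed.

(** The counterpart of [cls_feed] for the inner composites in the associativity squares, whose
    inputs may be numbered differently. Once the cast is gone, [e] must be [l'] after the inverse of
    [l], hence bijective. *)
Lemma relabelled_feed (X Y : sseq) n n' d k k' (x : X k d) (b : 'I_k' -> nat)
    (y : forall j, Y (b j) d) (f f' : 'I_k -> 'I_k') (E : f =1 f')
    (l : slots (fun i => b (f i)) -> 'I_n') (l' : slots (fun i => b (f' i)) -> 'I_n)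
    (h : bijective l) (h' : bijective l') (e : 'I_n' -> 'I_n) :
  (forall u, e (l u) = l' (slots_cast E u)) ->
  relabelled (mk x (fun i => y (f' i)) h' : ccomp X Y n d) e
             (mk x (fun i => y (f i)) h).
Proof.
have ff : f = f' by apply/funext.
subst f' => ll; have {}ll u : e (l u) = l' u by rewrite ll slots_cast_id.
apply: relabelled_cls => [|he].
  have [g lg gl] := h.
  apply: (eq_bij (bij_comp h' (Bijective gl lg))) => i /=.
  by rewrite -ll gl.
by congr cls; apply: cpre_eq.
Qed.

(** * Product labels on the extended slots *)

Section Labels.
Variables (n k m : nat) (a : 'I_k -> nat) (l : slots a -> 'I_m).

(** This label and the next are both [l] times the identity of ['I_n], for two ways of multiplying
    the slots by [n]: enlarging each block ['I_(a i)] to ['I_(a i * n)], or taking [n] copies of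
    it. *)
Definition lext_label (u : slots (fun i => a i * n)) : 'I_(m * n) :=
  mxtens_index (l (existT _ (tag u) (mxtens_unindex (tagged u)).1),
                (mxtens_unindex (tagged u)).2).

Definition rext_label (u : slots (fun r : 'I_(k * n) => a (mxtens_unindex r).1)) :
    'I_(m * n) :=
  mxtens_index (l (existT _ (mxtens_unindex (tag u)).1 (tagged u)),
                (mxtens_unindex (tag u)).2).

Lemma lext_labelE i j t :
  lext_label (existT _ i (mxtens_index (j, t))) = mxtens_index (l (existT _ i j), t).
Proof. by rewrite /lext_label mxtens_indexK. Qed.

Hypothesis hl : bijective l.

Lemma lext_label_bij : bijective lext_label.
Proof.
apply: inj_surj_bij => [[i r] [i' r']|v].
  move=> /(can_inj (@mxtens_indexK _ _)) [] /(bij_inj hl)/eqP.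
  rewrite -tag_eqE /tag_eq /= => /andP[/eqP ei]; subst i'.
  rewrite tagged_asE /= => /eqP/(congr1 val) /= e1 e2; congr existT; apply: val_inj.
  (* [e1] equates the quotients by [n], [e2] the remainders. *)
  by rewrite /= (divn_eq r n) (divn_eq r' n) e1 e2.
have [g _ gK] := hl; case: (mxtens_indexP v) => i t.
case: (g i) (gK i) => i0 j <-.
exists (existT (fun i => 'I_(a i * n)) i0 (mxtens_index (j, t))).
by rewrite lext_labelE.
Qed.

Lemma rext_label_bij : bijective rext_label.
Proof.
apply: inj_surj_bij => [[r j] [r' j']|v].
  move=> /(can_inj (@mxtens_indexK _ _)) [] /(bij_inj hl) /= e1 e2.
  have er : r = r'.
    rewrite -[LHS]mxtens_unindexK -[RHS]mxtens_unindexK.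
    by congr mxtens_index; congr pair; [exact: (congr1 (@tag _ _) e1) | apply: val_inj].
  subst r'; move/eqP: e1.
  by rewrite -tag_eqE /tag_eq eqxx tagged_asE => /eqP /= ->.
have [g _ gK] := hl; case: (mxtens_indexP v) => i t.
case: (g i) (gK i) => i0 j <-.
(* The block sought is copy [t] of block [i0]. Keeping [r] abstract lets [E] replace
   [(mxtens_unindex r).1] by [i0] at the end. *)
have [r Er] : exists r : 'I_(k * n), mxtens_unindex r = (i0, t).
  by exists (mxtens_index (i0, t)); rewrite mxtens_indexK.
have E : i0 = (mxtens_unindex r).1 by rewrite Er.
exists (existT (fun r : 'I_(k * n) => 'I_(a (mxtens_unindex r).1)) r
          (cast_ord (congr1 a E) j)).
rewrite /rext_label [X in (_, X)](congr1 snd Er : (mxtens_unindex r).2 = t).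
congr (mxtens_index (l _, _)).
change (existT (fun i => 'I_(a i)) (mxtens_unindex r).1 (cast_ord (congr1 a E) j)
        = existT _ i0 j).
by case: _ / E; rewrite cast_ord_id.
Qed.

End Labels.

(** Acting by a permutation on a composite relabels by its inverse, so equivariance of the extension
    maps involves the inverse of [nu s 1]. *)
Lemma nu1V m n (s : 'S_m) : ((@nu m n s 1)^-1 = nu s^-1 1)%g.
Proof. by apply: (mulgI (nu s 1)); rewrite mulgV -nuM mulgV mulg1 nu1. Qed.

Lemma nuE m n (s : 'S_m) (t : 'S_n) i j :
  nu s t (mxtens_index (i, j)) = mxtens_index (s i, t j).
Proof. by rewrite permE /nu_fun mxtens_indexK. Qed.

(** * The two extension maps on coinvariants *)

Section LeftExtension.
Variables (n : nat) (X Y : sseq).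

Definition lext_pre m d (u : cpre X (divpow_obj n Y) m d) : cset X Y (m * n) d :=
  cls _ (@CPre X Y (m * n) d (ck u) (cx u) (fun i => ca u i * n) (cy u) _
           (lext_label_bij n (clP u))).

(** Since gY carries the action through [nu], permuting the inputs of [y i] by [s i] in gY is
    permuting them by [nu (s i) 1] in Y. Block permutations carry over unchanged. *)
Lemma lext_pre_step m d (u v : cpre X (divpow_obj n Y) m d) :
  cstep u v -> lext_pre u = lext_pre v.
Proof.
case=> [k x a y s l h h'|k x a y s l h h'].
  apply: (@cls_inner X Y _ d k x (fun i => a i * n) y _
            (fun i => nu (s i) 1%g)) => // i j.
  by case: (mxtens_indexP j) => j0 t; rewrite nuE !lext_labelE perm1.
exact: (@cls_outer X Y _ d k x _ (fun i => a i * n) y s).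
Qed.

Definition lext_map m d (q : cset X (divpow_obj n Y) m d) : cset X Y (m * n) d :=
  lext_pre (rep q).

Lemma lext_mapE m d (u : cpre X (divpow_obj n Y) m d) :
  lext_map (cls _ u) = lext_pre u.
Proof. by apply: (rep_cls (f := @lext_pre m d)) => v w; apply: lext_pre_step. Qed.

End LeftExtension.

Section RightExtension.
Variables (n : nat) (X Y : sseq).

Definition rext_pre m d (u : cpre (divpow_obj n X) Y m d) : cset X Y (m * n) d :=
  cls _ (@CPre X Y (m * n) d (ck u * n) (cx u)
           (fun r => ca u (mxtens_unindex r).1)
           (fun r => cy u (mxtens_unindex r).1) _ (rext_label_bij n (clP u))).

(** A permutation of the inputs of [y i] is repeated on each copy. A block permutation [s] acts on
    [x] through [nu s 1], which sends [(i, t)] to [(s i, t)] and thus permutes the copied blocks in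
    the same way. *)
Lemma rext_pre_step m d (u v : cpre (divpow_obj n X) Y m d) :
  cstep u v -> rext_pre u = rext_pre v.
Proof.
case=> [k x a y s l h h'|k x a y s l h h'].
  exact: (@cls_inner X Y _ d (k * n) x (fun r => a (mxtens_unindex r).1) _ _
            (fun r => s (mxtens_unindex r).1)).
pose l0 := rext_label l (n := n); have h0 := rext_label_bij n h : bijective l0.
(* [f] repeats the permuted family and [f'] permutes the repeated one; they agree only
   propositionally, hence the intermediate class over [f']. *)
pose f (r : 'I_(k * n)) := s (mxtens_unindex r).1.
pose f' (r : 'I_(k * n)) := (mxtens_unindex (nu s 1%g r)).1.
have E : f =1 f' by move=> r; rewrite /f' permE /nu_fun mxtens_indexK.
have h1 := bij_comp h0 (@tag_reindex_bij _ _
  (fun r : 'I_(k * n) => 'I_(a (mxtens_unindex r).1)) _ (perm_bij (nu s 1%g))).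
transitivity (mk (sact (nu s 1%g) d x : X (k * n) d) (fun r => y (f' r)) h1); last first.
  exact: (@cls_outer X Y _ d (k * n) x _ (fun r => a (mxtens_unindex r).1)).
apply: (@cls_feed X Y _ _ _ _ _ a y _ _ E) => w.
apply: (congr2 (fun v t => mxtens_index (l v, t))); first exact: esym (slots_castE (b := a) E w).
change ((mxtens_unindex (tag w)).2 = (mxtens_unindex (nu s 1%g (tag w))).2).
by case: (mxtens_indexP (tag w)) => i t; rewrite nuE !mxtens_indexK perm1.
Qed.

Definition rext_map m d (q : cset (divpow_obj n X) Y m d) : cset X Y (m * n) d :=
  rext_pre (rep q).

Lemma rext_mapE m d (u : cpre (divpow_obj n X) Y m d) :
  rext_map (cls _ u) = rext_pre u.
Proof. by apply: (rep_cls (f := @rext_pre m d)) => v w; apply: rext_pre_step. Qed.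

End RightExtension.

(** * Naturality of the extension maps *)

Section Naturality.
Variables (n : nat) (X X' Y Y' : sseq) (m m' d d' : nat).
Variables (f : forall k, X k d -> X' k d') (g : forall k, Y k d -> Y' k d').
Variables (e : 'I_m -> 'I_m') (he : bijective e).
Variables (e' : 'I_(m * n) -> 'I_(m' * n)) (he' : bijective e').
Hypotheses (hf : equivariant f) (hg : equivariant g).
Hypothesis ee : forall i t, e' (mxtens_index (i, t)) = mxtens_index (e i, t).

(** Degree and relabelling vary together with [f] and [g], so that compatibility with simplicial
    operators, with permutations and with morphisms are all instances. The hypothesis [ee] says that
    [e'] is [e] times the identity. *)
Lemma lext_map_nat (q : cset X (divpow_obj n Y) m d) :
  lext_map (@cset_map X (divpow_obj n Y) X' (divpow_obj n Y') m m' d d'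
              f (fun k => @g (k * n)) e he q) =
  cset_map f g he' (lext_map q).
Proof.
have hgn : equivariant (Z := divpow_obj n Y) (Z' := divpow_obj n Y')
  (fun k => @g (k * n)) by move=> k s y; apply: hg.
rewrite -[q]repK cset_mapE // !lext_mapE cset_mapE //.
by congr cls; apply: cpre_eq => //= u; exact/esym/ee.
Qed.

Lemma rext_map_nat (q : cset (divpow_obj n X) Y m d) :
  rext_map (@cset_map (divpow_obj n X) Y (divpow_obj n X') Y' m m' d d'
              (fun k => @f (k * n)) g e he q) =
  cset_map f g he' (rext_map q).
Proof.
have hfn : equivariant (Z := divpow_obj n X) (Z' := divpow_obj n X')
  (fun k => @f (k * n)) by move=> k s x; apply: hf.
rewrite -[q]repK cset_mapE // !rext_mapE cset_mapE //.
by congr cls; apply: cpre_eq => //= u; exact/esym/ee.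
Qed.

End Naturality.

Program Definition lext (n : nat) (X Y : sseq) :
    sseq_hom (X \oc divpow_obj n Y) (divpow_obj n (X \oc Y)) :=
  @SSeqHom (X \oc divpow_obj n Y) (divpow_obj n (X \oc Y))
    (fun m => @SSetHom (csset X (divpow_obj n Y) m) (csset X Y (m * n))
      (fun d => @lext_map n X Y m d) _) _.
Next Obligation. exact: lext_map_nat. Qed.
Next Obligation.
apply: (lext_map_nat (g := fun k y => y)) => // i t.
by rewrite nu1V nuE perm1.
Qed.

Program Definition rext (n : nat) (X Y : sseq) :
    sseq_hom (divpow_obj n X \oc Y) (divpow_obj n (X \oc Y)) :=
  @SSeqHom (divpow_obj n X \oc Y) (divpow_obj n (X \oc Y))
    (fun m => @SSetHom (csset (divpow_obj n X) Y m) (csset X Y (m * n))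
      (fun d => @rext_map n X Y m d) _) _.
Next Obligation. exact: rext_map_nat. Qed.
Next Obligation.
apply: (rext_map_nat (f := fun k y => y)) => // i t.
by rewrite nu1V nuE perm1.
Qed.

Lemma lext_nat n (X X' Y Y' : sseq) (f : sseq_hom X X') (g : sseq_hom Y Y') :
  lext n X' Y' ** (f \om divpow_hom n g) = divpow_hom n (f \om g) ** lext n X Y.
Proof. by apply: sseq_hom_eq => m d q; apply: lext_map_nat. Qed.

Lemma rext_nat n (X X' Y Y' : sseq) (f : sseq_hom X X') (g : sseq_hom Y Y') :
  rext n X' Y' ** (divpow_hom n f \om g) = divpow_hom n (f \om g) ** rext n X Y.
Proof. by apply: sseq_hom_eq => m d q; apply: rext_map_nat. Qed.

(** * Compatibility with units and associators *)

Lemma lext_unit n (X : sseq) :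
  lext n cunit X ** lunitV (divpow_obj n X) = divpow_hom n (lunitV X).
Proof.
apply: sseq_hom_eq => m d x; rewrite /= lext_mapE.
congr cls; apply: cpre_eq => // -[i j] /=.
by rewrite /lext_label -[RHS]mxtens_unindexK.
Qed.

Lemma rext_unit n (X : sseq) :
  rext n X cunit ** runitV (divpow_obj n X) = divpow_hom n (runitV X).
Proof.
apply: sseq_hom_eq => m d x; rewrite /= rext_mapE.
congr cls; apply: cpre_eq => // -[i j] /=.
by rewrite /rext_label -[RHS]mxtens_unindexK.
Qed.

Lemma lext_assoc n (X Y Z : sseq) :
  divpow_hom n (assoc X Y Z) ** lext n (X \oc Y) Z =
  lext n X (Y \oc Z) ** (1_X \om lext n Y Z) ** assoc X Y (divpow_obj n Z).
Proof.
apply: sseq_hom_eq => m d q; rewrite /=.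
rewrite -[q]repK; case: (rep q) => k w b z l hl.
rewrite -[w]repK; case: (rep w) => k1 x a y p hp.
rewrite lext_mapE /lext_pre /= !assoc_mapE /assoc_pre /= cset_mapE; last 2 first.
- exact: id_equivariant.
- exact: (qhom_equivariant (lext n Y Z)).
rewrite lext_mapE /lext_pre.
(* The sides differ in how the inputs of the inner composite are numbered: the left enumerates the
   slots of sizes [b j * n], the right enumerates those of sizes [b j] and then multiplies by [n].
   The relabelling translates the first numbering into the second. *)
apply: (@cls_relabel X (Y \oc Z) _ d k1 x _ _ _ _
  (fun i r => lext_label enum_rank (enum_val r))) => i /=; last first.
  move=> r; rewrite /assoc_label /=.
  case: (enum_val r) => j t /=; case: (mxtens_indexP t) => t0 t1.
  by rewrite [lext_label enum_rank _]lext_labelE !lext_labelE /= enum_rankK.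
rewrite lext_mapE /lext_pre /=.
apply: (@relabelled_feed Y Z _ _ d _ _ (y i) (fun j => b j * n) z _ _
  (fun j => erefl (p (existT _ i j)))) => u.
by rewrite enum_rankK slots_cast_id.
Qed.

Lemma rext_assoc n (X Y Z : sseq) :
  divpow_hom n (assoc X Y Z) ** rext n (X \oc Y) Z ** (rext n X Y \om 1_Z) =
  rext n X (Y \oc Z) ** assoc (divpow_obj n X) Y Z.
Proof.
apply: sseq_hom_eq => m d q; rewrite /=.
rewrite -[q]repK; case: (rep q) => k w b z l hl.
rewrite -[w]repK; case: (rep w) => k1 x a y p hp.
rewrite cset_mapE; last 2 first.
- exact: (qhom_equivariant (rext n X Y)).
- exact: id_equivariant.
rewrite rext_mapE /rext_pre /= rext_mapE /rext_pre /= !assoc_mapE /assoc_pre.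
rewrite rext_mapE /rext_pre /=.
(* On the left, the index of the [z] fed to slot [(r, j)] is extracted from a product label; on the
   right it is read off [p]. Up to this equality both sides have the same slots, so the relabelling
   is a cast between their enumerations. *)
have E (r : 'I_(k1 * n)) j : (mxtens_unindex (rext_label p (existT _ r j))).1 =
    p (existT _ (mxtens_unindex r).1 j) by rewrite mxtens_indexK.
apply: (@cls_relabel X (Y \oc Z) _ d _ x _ _ _ _
  (fun r v => enum_rank (slots_cast (E r) (enum_val v)))) => r /=; last first.
  move=> v; rewrite /assoc_label /=.
  rewrite [RHS]/rext_label /= enum_rankK.
  set v' := enum_val v.
  apply: (congr2 (fun u t => mxtens_index (l u, t))).
    exact: esym (slots_castE (b := b) (E r) v').
  exact: (congr1 snd (mxtens_indexK _)).
apply: (@relabelled_feed Y Z _ _ d _ _ (y (mxtens_unindex r).1) b z _ _ (E r)) => u.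
by rewrite enum_rankK.
Qed.

Lemma lext_rext_assoc n (X Y Z : sseq) :
  divpow_hom n (assoc X Y Z) ** rext n (X \oc Y) Z ** (lext n X Y \om 1_Z) =
  lext n X (Y \oc Z) ** (1_X \om rext n Y Z) ** assoc X (divpow_obj n Y) Z.
Proof.
apply: sseq_hom_eq => m d q; rewrite /=.
rewrite -[q]repK; case: (rep q) => k w b z l hl.
rewrite -[w]repK; case: (rep w) => k1 x a y p hp.
rewrite cset_mapE; last 2 first.
- exact: (qhom_equivariant (lext n X Y)).
- exact: id_equivariant.
rewrite rext_mapE /rext_pre /= lext_mapE /lext_pre /= !assoc_mapE /assoc_pre.
rewrite cset_mapE; last 2 first.
- exact: id_equivariant.
- exact: (qhom_equivariant (rext n Y Z)).
rewrite lext_mapE /lext_pre /=.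
have E i (r : 'I_(a i * n)) : (mxtens_unindex (lext_label p (existT _ i r))).1 =
    p (existT _ i (mxtens_unindex r).1) by rewrite mxtens_indexK.
(* On the left, [y i] is fed with the repeated [z] and the [a i * n] blocks are enumerated at once;
   on the right, the slots over [a i] are enumerated before being repeated. Besides the cast along
   [E], the relabelling therefore moves the copy number into the second coordinate. *)
apply: (@cls_relabel X (Y \oc Z) _ d _ x _ _ _ _
  (fun i v => @rext_label n (a i) _ (fun j => b (p (existT _ i j))) enum_rank
                (slots_cast (E i) (enum_val v)))) => i /=; last first.
  move=> v; rewrite /assoc_label /=.
  rewrite lext_labelE /= enum_rankK.
  set v' := enum_val v.
  rewrite [LHS]/rext_label; apply: (congr2 (fun u t => mxtens_index (l u, t))).
    exact: esym (slots_castE (b := b) (E i) v').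
  by rewrite mxtens_indexK.
rewrite rext_mapE /rext_pre /=.
apply: (@relabelled_feed Y Z _ _ d _ _ (y i) b z _ _ (E i)) => u.
by rewrite enum_rankK.
Qed.

(** * The lift to bimodules *)

Lemma divpow_hom_id n (X : sseq) : divpow_hom n 1_X = 1_(divpow_obj n X).
Proof. exact: (fmap_id (divpow n)). Qed.

Lemma divpow_hom_comp n (X Y Z : sseq) (g : sseq_hom Y Z) (f : sseq_hom X Y) :
  divpow_hom n (g ** f) = divpow_hom n g ** divpow_hom n f.
Proof. exact: (fmap_comp (divpow n)). Qed.

Lemma ccomp_hom_compl (X X' X'' Y : sseq) (f' : sseq_hom X' X'') (f : sseq_hom X X') :
  (f' ** f) \om 1_Y = (f' \om 1_Y) ** (f \om 1_Y).
Proof. by rewrite -ccomp_hom_comp [1_Y ** 1_Y]comp1m. Qed.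

Lemma ccomp_hom_compr (X Y Y' Y'' : sseq) (g' : sseq_hom Y' Y'') (g : sseq_hom Y Y') :
  1_X \om (g' ** g) = (1_X \om g') ** (1_X \om g).
Proof. by rewrite -ccomp_hom_comp [1_X ** 1_X]comp1m. Qed.

Section DividedPowerBimodule.
Variables (P Q : operad) (n : nat).

(** In each axiom, naturality slides the extension maps past the structure maps of X, P and Q, and a
    unit or associator compatibility collects them on one side. What remains is the image under g of
    the same axiom for X. *)
Program Definition divpow_bimod (X : bimod P Q) : bimod P Q :=
  @BiMod P Q (divpow_obj n X)
    (divpow_hom n (bm_l X) ** lext n P X) (divpow_hom n (bm_r X) ** rext n X Q)
    _ _ _ _ _.
Next Obligation.
rewrite ccomp_hom_compr -!compmA -{1}divpow_hom_id lext_nat.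
rewrite [lext n P X ** _]compmA lext_nat -!compmA.
rewrite [lext n P _ ** _]compmA -lext_assoc !compmA -!divpow_hom_comp.
by rewrite bm_lA.
Qed.
Next Obligation.
rewrite -!compmA [lext n P X ** _]compmA -divpow_hom_id lext_nat -compmA lext_unit.
by rewrite -!divpow_hom_comp compmA bm_l1 divpow_hom_id.
Qed.
Next Obligation.
rewrite ccomp_hom_compl -!compmA -[1_(divpow_obj n X)]divpow_hom_id.
rewrite [rext n X Q ** (_ ** _)]compmA rext_nat.
rewrite [rext n X Q ** (_ ** _)]compmA rext_nat -!compmA -rext_assoc.
by rewrite !compmA -!divpow_hom_comp bm_rA.
Qed.
Next Obligation.
rewrite -!compmA [rext n X Q ** _]compmA -divpow_hom_id rext_nat -compmA rext_unit.
by rewrite -!divpow_hom_comp compmA bm_r1 divpow_hom_id.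
Qed.
Next Obligation.
rewrite ccomp_hom_compl ccomp_hom_compr -!compmA.
rewrite [rext n X Q ** (_ ** _)]compmA rext_nat.
rewrite [lext n P X ** (_ ** _)]compmA lext_nat -!compmA.
rewrite [lext n P _ ** (_ ** _)]compmA -lext_rext_assoc.
by rewrite !compmA -!divpow_hom_comp bm_lr.
Qed.

Program Definition divpow_bimod_hom (X Y : bimod P Q) (f : bimod_hom X Y) :
    bimod_hom (divpow_bimod X) (divpow_bimod Y) :=
  @BiModHom P Q (divpow_bimod X) (divpow_bimod Y) (divpow_hom n f) _ _.
Next Obligation. by rewrite compmA -divpow_hom_comp bmh_l divpow_hom_comp -!compmA lext_nat. Qed.
Next Obligation. by rewrite compmA -divpow_hom_comp bmh_r divpow_hom_comp -!compmA rext_nat. Qed.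

Program Definition divpow_Bimod : functor (Bimod P Q) (Bimod P Q) :=
  @Functor (Bimod P Q) (Bimod P Q) divpow_bimod divpow_bimod_hom _ _.
Next Obligation. by apply: bimod_hom_eq; apply: divpow_hom_id. Qed.
Next Obligation. by apply: bimod_hom_eq; apply: divpow_hom_comp. Qed.

End DividedPowerBimodule.

Theorem proposition2p1 (P Q : operad) (n : nat) (hn : (1 <= n)%N) :
  exists G : functor (Bimod P Q) (Bimod P Q),
    functor_comp (forget P Q) G = functor_comp (divpow n) (forget P Q).
Proof.
exists (divpow_Bimod P Q n).
(* The two composites agree on objects and morphisms by computation; only the proofs of the functor
   laws have to be identified. *)
by rewrite /functor_comp /=; congr Functor; apply: Prop_irrelevance.
Qed.
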